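(* For each positive integer $j$, let $T_j=[\underbrace{2\;2\;\cdots\;2}_{j}]_4=\sum_{i=0}^{j-1}2\cdot 4^i$ and $U_j=[\underbrace{1\;1\;\cdots\;1}_{j}]_4=\sum_{i=0}^{j-1}4^i$. Then $$f_4(T_j+n)=b_4(n)\quad\text{for all integers } n\in[-U_j,\,U_{j+1}].$$ Moreover, $f_4(T_j+n)\neq b_4(n)$ when $n=-U_j-1$ and when $n=U_{j+1}+1$.
   Context: For an integer $n$, a hyperquaternary representation of $n$ is an expression $n=\sum_{i\ge 0}\epsilon_i 4^i$ with finitely many nonzero $\epsilon_i$ and all $\epsilon_i\in\{0,1,2,3,4\}$; $f_4(n)$ denotes the number of such representations (so $f_4(n)=0$ for $n<0$). A balanced quaternary representation of $n$ is such an expression with all $\epsilon_i\in\{-2,-1,0,1,2\}$; $b_4(n)$ denotes the number of such representations. Representations differing only by leading zero digits are identified. The notation $[\epsilon_k\;\epsilon_{k-1}\;\cdots\;\epsilon_0]_4$ means $\sum_{i=0}^k\epsilon_i4^i$. *)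

(* Defs.v *)
From mathcomp Require Import all_boot all_order all_algebra.
From mathcomp Require Import finmap.
From mathcomp Require Import classical_sets cardinality.

Set Implicit Arguments.
Unset Strict Implicit.
Unset Printing Implicit Defensive.

Import Order.TTheory GRing.Theory Num.Theory.

Local Open Scope ring_scope.
Local Open Scope classical_set_scope.

(* [eps i] is the digit at place [i].  A finitely supported digit sequence
   carries no information about leading zeros, so representations that differ
   only by leading zeros are the same element. *)
Definition digit_seq := {fsfun nat -> int with 0}.

Definition value4 (eps : digit_seq) : int :=
  \sum_(i <- finsupp eps) eps i * 4 ^+ i.

Definition reps4 (lo hi n : int) : set digit_seq :=
  [set eps : digit_seq | (forall i, lo <= eps i <= hi) /\ value4 eps = n].

(* [fset_set] is the empty set on infinite sets; this default does not arise
   in [f4] and [b4], because a nonzero leading digit at place [k] forces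
   [3 * `|n| > 4 ^ k], so each [n] has finitely many representations. *)
Definition count_reps4 (lo hi n : int) : nat :=
  #|` fset_set (reps4 lo hi n)|%fset.

Definition f4 (n : int) : nat := count_reps4 0 4 n.

Definition b4 (n : int) : nat := count_reps4 (- 2) 2 n.

Definition T_ (j : nat) : int := \sum_(0 <= i < j) 2 * 4 ^+ i.

Definition U_ (j : nat) : int := \sum_(0 <= i < j) 4 ^+ i.

(* Main.v *)
Require Import Defs.
From mathcomp Require Import all_boot all_order all_algebra.
From mathcomp Require Import finmap.
From mathcomp Require Import classical_sets cardinality.
From mathcomp Require Import zify.

(** Removing the last digit gives [f4 (4 m + r) = f4 m] for [r = 1, 2, 3] and
    [f4 (4 m) = f4 m + f4 (m - 1)], whereas [b4 (4 m + r) = b4 m] for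
    [r = -1, 0, 1] and [b4 (4 m + 2) = b4 m + b4 (m + 1)].  As
    [T_ j.+1 = 4 * T_ j + 2], the functions [n |-> f4 (T_ j.+1 + n)] and [b4]
    are obtained from [n |-> f4 (T_ j + n)] and [b4] by the same rule, so
    agreement on [- U_ j, U_ j.+1] propagates by induction from
    [f4 0 = f4 1 = b4 0 = b4 1 = 1].  The two points adjacent to the interval
    are of the form [4 m + 2], where one of [m], [m + 1] lies in the previous
    interval and the other is adjacent to it, so the disagreement propagates
    as well. *)

Import Order.TTheory GRing.Theory Num.Theory.

Local Open Scope ring_scope.

(** * Adding and removing the last digit *)

Definition cons_digit (d : int) (e : digit_seq) : digit_seq :=
  [fsfun i in (0%N |` [fset k.+1 | k in finsupp e])%fset =>
     (if (i : nat) is k.+1 then e k else d) | 0].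

(** The truncated [k.-1] sends both [0] and [1] to the key [0]; this is harmless, since the value
    stored there is [e 1] in either case. *)
Definition tail_digits (e : digit_seq) : digit_seq :=
  [fsfun i in [fset k.-1 | k in finsupp e]%fset => e i.+1 | 0].

Lemma cons_digit0 d e : cons_digit d e 0%N = d.
Proof. by rewrite fsfunE in_fset1U. Qed.

Lemma cons_digitS d e i : cons_digit d e i.+1 = e i.
Proof.
rewrite fsfunE; case: ifPn => //; rewrite in_fset1U /= => ni.
rewrite fsfun_dflt //; apply: contra ni => ei.
by apply/imfsetP; exists i.
Qed.

Lemma tail_digitsE e i : tail_digits e i = e i.+1.
Proof.
rewrite fsfunE; case: ifPn => // ni; rewrite fsfun_dflt //.
by apply: contra ni => ei; apply/imfsetP; exists i.+1.
Qed.

Lemma cons_tail_digits (e : digit_seq) :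
  cons_digit (e 0%N) (tail_digits e) = e.
Proof.
apply/fsfunP => -[|i]; first by rewrite cons_digit0.
by rewrite cons_digitS tail_digitsE.
Qed.

Lemma cons_digit_inj d : injective (cons_digit d).
Proof.
move=> e e' ee'; apply/fsfunP => i.
by rewrite -(cons_digitS d e) ee' cons_digitS.
Qed.

Lemma value4_cons d e : value4 (cons_digit d e) = d + 4 * value4 e.
Proof.
set S := (0%N |` [fset k.+1 | k in finsupp e])%fset.
(* [S] may exceed the support, for instance when [d = 0]; the extra terms vanish. *)
have -> : value4 (cons_digit d e) =
    \sum_(i <- S) cons_digit d e i * 4 ^+ i.
  apply: big_fset_incl => [|i _ ni]; last by rewrite fsfun_dflt ?mul0r.
  apply/fsubsetP => i; apply: contraLR => ni.
  by rewrite memNfinsupp fsfunE (negPf ni).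
rewrite big_fsetU1 /=; last by apply/imfsetP => -[].
rewrite cons_digit0 expr0 mulr1 big_imfset /=; last by move=> i k _ _ [].
rewrite big_distrr /=; congr (_ + _); apply: eq_bigr => i _.
by rewrite cons_digitS exprS mulrCA.
Qed.

Lemma value4_split (e : digit_seq) :
  value4 e = e 0%N + 4 * value4 (tail_digits e).
Proof. by rewrite -{1}(cons_tail_digits e) value4_cons. Qed.

(** * Recursion on the last digit, for a general digit range *)

Section Recursion.
Variables lo hi : int.
Implicit Types (d m n : int) (e : digit_seq).

Lemma reps4_cons d m e : lo <= d <= hi -> reps4 lo hi m e ->
  reps4 lo hi (d + 4 * m) (cons_digit d e).
Proof.
move=> dP [eP <-]; split; last exact: value4_cons.
by case=> [|i]; rewrite ?cons_digit0 ?cons_digitS.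
Qed.

Lemma reps4_tail e : (forall i, lo <= e i <= hi) ->
  reps4 lo hi (value4 (tail_digits e)) (tail_digits e).
Proof. by move=> eP; split=> // i; rewrite tail_digitsE. Qed.

(** The bounds make [d] the only admissible digit in its class modulo 4, so the last digit is
    forced. *)
Lemma reps4_digit1 d m : lo <= d <= hi -> d < lo + 4 -> hi < d + 4 ->
  reps4 lo hi (d + 4 * m) = (cons_digit d @` reps4 lo hi m)%classic.
Proof.
move=> dP dlo dhi; apply/seteqP; split=> [e [eP ve]|_ [e eP <-]]; last first.
  exact: reps4_cons.
have e0P := eP 0%N; move: ve; rewrite value4_split => ve.
have [e0 vm] : e 0%N = d /\ value4 (tail_digits e) = m by split; lia.
by exists (tail_digits e); rewrite -?e0 ?cons_tail_digits // -vm; exact: reps4_tail.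
Qed.

(** Here exactly [d] and [d + 4] are admissible in the class of [d]; choosing [d + 4] lowers the
    remaining value by 1. *)
Lemma reps4_digit2 d m : lo <= d -> d + 4 <= hi -> d < lo + 4 -> hi < d + 8 ->
  reps4 lo hi (d + 4 * m) =
  (cons_digit d @` reps4 lo hi m `|`
   cons_digit (d + 4) @` reps4 lo hi (m - 1))%classic.
Proof.
move=> lod dhi dlo hid.
apply/seteqP; split=> [e [eP ve]|_ [[e eP <-]|[e eP <-]]]; last 2 first.
- by apply: reps4_cons => //; lia.
- have -> : d + 4 * m = (d + 4) + 4 * (m - 1) by lia.
  by apply: reps4_cons => //; lia.
have e0P := eP 0%N; move: ve; rewrite value4_split => ve.
have [[e0 vm]|[e0 vm]] : e 0%N = d /\ value4 (tail_digits e) = m \/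
    e 0%N = d + 4 /\ value4 (tail_digits e) = m - 1 by lia.
- left; exists (tail_digits e); rewrite -?e0 ?cons_tail_digits // -vm.
  exact: reps4_tail.
- right; exists (tail_digits e); rewrite -?e0 ?cons_tail_digits // -vm.
  exact: reps4_tail.
Qed.

Lemma count_reps4_digit1 d m : finite_set (reps4 lo hi m) ->
  lo <= d <= hi -> d < lo + 4 -> hi < d + 4 ->
  count_reps4 lo hi (d + 4 * m) = count_reps4 lo hi m.
Proof.
move=> fm dP dlo dhi.
rewrite /count_reps4 reps4_digit1 // fset_set_image // card_imfset //.
exact: cons_digit_inj.
Qed.

Lemma count_reps4_digit2 d m :
  finite_set (reps4 lo hi m) -> finite_set (reps4 lo hi (m - 1)) ->
  lo <= d -> d + 4 <= hi -> d < lo + 4 -> hi < d + 8 ->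
  count_reps4 lo hi (d + 4 * m) =
  (count_reps4 lo hi m + count_reps4 lo hi (m - 1))%N.
Proof.
move=> fm fm1 lod dhi dlo hid; rewrite /count_reps4 reps4_digit2 //.
rewrite fset_setU; try exact: finite_image.
rewrite !fset_set_image // cardfsU.
(* The two images are disjoint because their last digits differ. *)
set I := (_ `&` _)%fset; suff -> : I = fset0.
  by rewrite cardfs0 subn0 !card_imfset //; exact: cons_digit_inj.
apply/fsetP => e; rewrite in_fset0; apply/negP; rewrite in_fsetI.
case/andP => /imfsetP[/= e1 _ ->] /imfsetP[/= e2 _] /(congr1 (fun e => e 0%N)).
rewrite !cons_digit0; lia.
Qed.

Lemma finite_reps4_digit1 d m : finite_set (reps4 lo hi m) ->
  lo <= d <= hi -> d < lo + 4 -> hi < d + 4 ->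
  finite_set (reps4 lo hi (d + 4 * m)).
Proof. by move=> fm *; rewrite reps4_digit1 //; exact: finite_image. Qed.

Lemma finite_reps4_digit2 d m :
  finite_set (reps4 lo hi m) -> finite_set (reps4 lo hi (m - 1)) ->
  lo <= d -> d + 4 <= hi -> d < lo + 4 -> hi < d + 8 ->
  finite_set (reps4 lo hi (d + 4 * m)).
Proof.
move=> fm fm1 *; rewrite reps4_digit2 // finite_setU.
by split; exact: finite_image.
Qed.

(* If [0] can only end in the digit [0], then removing that digit gives again
   a representation of [0], and so on. *)
Lemma reps40 : lo <= 0 <= hi ->
  (forall e, reps4 lo hi 0 e -> e 0%N = 0) ->
  reps4 lo hi 0 = [set [fsfun]]%classic.
Proof.
move=> z0 H; apply/seteqP; split=> [e eP|_ ->]; last first.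
  by split=> [i|]; rewrite ?fsfunE // /value4 finsupp0 big_seq_fset0.
apply/fsfunP => i; rewrite fsfunE.
elim: i e eP => [|i IHi] e eP; first exact: H.
rewrite -tail_digitsE; apply: IHi.
have e0 := H _ eP; case: eP => eP; rewrite value4_split e0 => v0.
by have <- : value4 (tail_digits e) = 0 by [lia]; exact: reps4_tail.
Qed.

End Recursion.

(** * Representations of 0 and finiteness *)

Lemma divmod4 (n : int) : exists m r : int, 0 <= r < 4 /\ n = r + 4 * m.
Proof.
exists (n %/ 4)%Z, (n %% 4)%Z; split; last by rewrite {1}(divz_eq n 4); lia.
by rewrite modz_ge0 // ltz_pmod.
Qed.

Lemma reps4_hyper_neg (n : int) : n < 0 -> reps4 0 4 n = set0.
Proof.
move=> n0; apply/seteqP; split=> // e [eP ve] /=.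
suff : 0 <= value4 e by rewrite ve leNgt n0.
apply: sumr_ge0 => i _; apply: mulr_ge0; last exact: exprn_ge0.
by case/andP: (eP i).
Qed.

Lemma reps4_hyper0 : reps4 0 4 0 = [set [fsfun]]%classic.
Proof.
apply: reps40 => // e [eP]; rewrite value4_split => v0; have e0P := eP 0%N.
(* The last digit is 0 or 4, and 4 would leave a tail of value -1. *)
have [//|v1] : e 0%N = 0 \/ value4 (tail_digits e) = - 1 by lia.
have := reps4_tail _ _ _ eP; rewrite v1 reps4_hyper_neg //.
Qed.

(** Strong induction on the absolute value: for [n > 0], removing the last digit leaves a smaller
    value or the value -1, which has no representation. *)
Lemma finite_reps4_hyper (n : int) : finite_set (reps4 0 4 n).
Proof.
have [k] := ubnP `|n|%N; elim: k n => // k IHk n nk.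
have [n0|n0] := ltP n 0; first by rewrite reps4_hyper_neg.
have [->|nz] := eqVneq n 0; first by rewrite reps4_hyper0.
have [m [r [rP nE]]] := divmod4 n.
have fm : finite_set (reps4 0 4 m) by apply: IHk; lia.
have [r0|r0] := eqVneq r 0; last first.
  by rewrite nE; apply: finite_reps4_digit1 => //; lia.
rewrite nE r0; apply: finite_reps4_digit2 => //.
have [m1|m1] := ltP (m - 1) 0; first by rewrite reps4_hyper_neg.
by apply: IHk; lia.
Qed.

Lemma reps4_balanced0 : reps4 (- 2) 2 0 = [set [fsfun]]%classic.
Proof.
apply: reps40 => // e [eP]; rewrite value4_split => v0; have e0P := eP 0%N.
lia.
Qed.

(** Among these residues only 2 is congruent to two balanced digits, 2 and -2. *)
Lemma balanced_divmod4 (n : int) :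
  exists m r : int, - 1 <= r <= 2 /\ n = r + 4 * m.
Proof.
have [m [r [rP nE]]] := divmod4 (n + 1).
by exists m, (r - 1); lia.
Qed.

Lemma finite_reps4_balanced (n : int) : finite_set (reps4 (- 2) 2 n).
Proof.
have [k] := ubnP `|n|%N; elim: k n => // k IHk n nk.
have [->|nz] := eqVneq n 0; first by rewrite reps4_balanced0.
have [m [r [rP nE]]] := balanced_divmod4 n.
have fm : finite_set (reps4 (- 2) 2 m) by apply: IHk; lia.
have [r2|r2] := eqVneq r 2; last first.
  by rewrite nE; apply: finite_reps4_digit1 => //; lia.
(* [finite_reps4_digit2] expects the smaller of the two possible digits, here -2. *)
have -> : n = - 2 + 4 * (m + 1) by lia.
apply: finite_reps4_digit2 => //; last by rewrite addrK.
have [->|m0] := eqVneq m 0; last by apply: IHk; lia.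
have -> : 0 + 1 = 1 + 4 * 0 :> int by [].
by apply: finite_reps4_digit1; rewrite // reps4_balanced0.
Qed.

(** * Recurrences for [f4] and [b4] *)

Lemma f4_neg (n : int) : n < 0 -> f4 n = 0%N.
Proof.
by move=> n0; rewrite /f4 /count_reps4 reps4_hyper_neg // fset_set0 cardfs0.
Qed.

Lemma f40 : f4 0 = 1%N.
Proof. by rewrite /f4 /count_reps4 reps4_hyper0 fset_set1 cardfs1. Qed.

Lemma b40 : b4 0 = 1%N.
Proof. by rewrite /b4 /count_reps4 reps4_balanced0 fset_set1 cardfs1. Qed.

Lemma f4_digit1 (r m : int) : 0 < r < 4 -> f4 (r + 4 * m) = f4 m.
Proof.
by move=> rP; apply: count_reps4_digit1; [exact: finite_reps4_hyper|lia..].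
Qed.

Lemma f4_digit2 (m : int) : f4 (4 * m) = (f4 m + f4 (m - 1))%N.
Proof.
rewrite -[4 * m]add0r.
by apply: count_reps4_digit2 => //; exact: finite_reps4_hyper.
Qed.

Lemma b4_digit1 (r m : int) : - 1 <= r <= 1 -> b4 (r + 4 * m) = b4 m.
Proof.
by move=> rP; apply: count_reps4_digit1; [exact: finite_reps4_balanced|lia..].
Qed.

Lemma b4_digit2 (m : int) : b4 (2 + 4 * m) = (b4 m + b4 (m + 1))%N.
Proof.
have -> : 2 + 4 * m = - 2 + 4 * (m + 1) by lia.
rewrite addnC -{3}(addrK 1 m).
by apply: count_reps4_digit2 => //; exact: finite_reps4_balanced.
Qed.

(** * Shifting by [T_ j] and the comparison *)

Lemma T_S j : T_ j.+1 = 4 * T_ j + 2.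
Proof.
rewrite /T_ big_nat_recl // expr0 mulr1 addrC big_distrr; congr (_ + _).
by apply: eq_bigr => i _; rewrite exprS mulrCA.
Qed.

Lemma U_S j : U_ j.+1 = 4 * U_ j + 1.
Proof.
rewrite /U_ big_nat_recl // expr0 addrC big_distrr; congr (_ + _).
by apply: eq_bigr => i _; rewrite exprS.
Qed.

(** The last digit 2 of [T_ j.+1] moves the residues -1, 0, 1 to 1, 2, 3, and the residue 2 to 0
    modulo 4, so the branching cases of [f4] and [b4] coincide. *)
Lemma f4_T_digit1 j (r m : int) : - 1 <= r <= 1 ->
  f4 (T_ j.+1 + (r + 4 * m)) = f4 (T_ j + m).
Proof.
move=> rP; have -> : T_ j.+1 + (r + 4 * m) = (r + 2) + 4 * (T_ j + m).
  by rewrite T_S; lia.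
by apply: f4_digit1; lia.
Qed.

Lemma f4_T_digit2 j (m : int) :
  f4 (T_ j.+1 + (2 + 4 * m)) = (f4 (T_ j + m) + f4 (T_ j + (m + 1)))%N.
Proof.
have -> : T_ j.+1 + (2 + 4 * m) = 4 * (T_ j + (m + 1)) by rewrite T_S; lia.
by rewrite f4_digit2 addnC; congr (f4 _ + _)%N; lia.
Qed.

Lemma f4_T_eq_b4 j (n : int) : - U_ j <= n <= U_ j.+1 -> f4 (T_ j + n) = b4 n.
Proof.
elim: j n => [|j IHj] n.
  (* For [j = 0] the shift is 0 and the interval is [[0, 1]]. *)
  rewrite U_S /U_ /T_ !big_nil => nP.
  have [->|->] : n = 0 \/ n = 1 + 4 * 0 by lia.
    by rewrite f40 b40.
  by rewrite add0r f4_digit1 // b4_digit1 // f40 b40.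
rewrite !(U_S j.+1) U_S => nP; have [m [r [rP nE]]] := balanced_divmod4 n.
have [r2|r2] := eqVneq r 2.
  (* Since [2 + 4 * m <= 4 * U_ j.+1 + 1] forces [m < U_ j.+1], the point [m + 1] is still in
     range. *)
  by rewrite nE r2 f4_T_digit2 b4_digit2 !IHj ?U_S //; lia.
by rewrite nE f4_T_digit1 ?b4_digit1 ?IHj ?U_S //; lia.
Qed.

Lemma U_ge0 j : 0 <= U_ j.
Proof. by apply: sumr_ge0 => i _; exact: exprn_ge0. Qed.

Lemma f4_T_neq_b4_low j : f4 (T_ j + (- U_ j - 1)) <> b4 (- U_ j - 1).
Proof.
elim: j => [|j IHj].
  (* At -1, [f4] is 0 and [b4] is 1. *)
  rewrite /U_ /T_ !big_nil add0r f4_neg //.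
  have -> : - 0 - 1 = - 1 + 4 * 0 :> int by [].
  by rewrite b4_digit1 // b40.
have -> : - U_ j.+1 - 1 = 2 + 4 * (- U_ j - 1) by rewrite U_S; lia.
have U0 := U_ge0 j.
rewrite f4_T_digit2 b4_digit2 (f4_T_eq_b4 j (- U_ j - 1 + 1)); last first.
  by rewrite U_S; lia.
by move/addIn.
Qed.

Lemma f4_T_neq_b4_high j :
  f4 (T_ j + (U_ j.+1 + 1)) <> b4 (U_ j.+1 + 1).
Proof.
elim: j => [|j IHj].
  (* At 2, [f4] is 1 and [b4] is 2. *)
  rewrite U_S /U_ /T_ !big_nil add0r.
  have -> : 4 * 0 + 1 + 1 = 2 + 4 * 0 :> int by [].
  rewrite f4_digit1 // b4_digit2 f40 b40.
  have -> : 0 + 1 = 1 + 4 * 0 :> int by [].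
  by rewrite b4_digit1 // b40.
(* Now [m = U_ j.+1] is the right endpoint of the previous interval; its equal contributions cancel,
   leaving the disagreement at [m + 1]. *)
have -> : U_ j.+2 + 1 = 2 + 4 * U_ j.+1 by rewrite U_S; lia.
have U0 := U_ge0 j.
rewrite f4_T_digit2 b4_digit2 (f4_T_eq_b4 j (U_ j.+1)); last first.
  by rewrite U_S; lia.
by move/addnI.
Qed.

Theorem theorem1p2 (j : nat) (hj : (0 < j)%N) :
  (forall n : int, - U_ j <= n <= U_ j.+1 -> f4 (T_ j + n) = b4 n) /\
  f4 (T_ j + (- U_ j - 1)) <> b4 (- U_ j - 1) /\
  f4 (T_ j + (U_ j.+1 + 1)) <> b4 (U_ j.+1 + 1).
Proof.
split; first exact: f4_T_eq_b4.
by split; [exact: f4_T_neq_b4_low | exact: f4_T_neq_b4_high].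
Qed.
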